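(* Let $\mathfrak A$ be projective and spanning, let $(\lambda_1,\dots,\lambda_r)$ be a $\mathbb Z$-basis of $\Gamma_{\mathfrak a}$, and let $z=\sum_i z_i\omega_i\in\mathfrak g_{\mathbb C}$ with $z_i\neq0$ for all $i$. Put $p_j(u)=\prod_{i=1}^n\alpha_i(u)^{\langle\alpha_i,\lambda_j\rangle}$ and $q_j=\prod_{i=1}^n z_i^{\langle\alpha_i,\lambda_j\rangle}$, $j=1,\dots,r$. Regard $O_{\mathfrak B}(z)$ as a subset of $\mathfrak a_{\mathbb C}$, via the embedding $w\mapsto(z_1e_{\beta_1}(w),\dots,z_ne_{\beta_n}(w))$ of $T=\mathfrak t_{\mathbb C}^*/\Gamma_{\mathfrak t}^*$ into $\mathfrak g_{\mathbb C}\cong\mathbb C^n$ (which maps $O_{\mathfrak B}(z)$ into $\mathfrak a_{\mathbb C}$). Then $$O_{\mathfrak B}(z)=\{u\in U(\mathfrak A):\ p_j(u)=q_j,\ j=1,\dots,r\}.$$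
   Context: Setting. Let $0\to\mathfrak a\to\mathfrak g\xrightarrow{\pi}\mathfrak t\to0$ be an exact sequence of real vector spaces of dimensions $r,n,d$, where $\mathfrak g=\bigoplus_{i=1}^n\mathbb R\omega_i$ has lattice $\Gamma_{\mathfrak g}=\bigoplus\mathbb Z\omega_i$; assume $\Gamma_{\mathfrak a}=\Gamma_{\mathfrak g}\cap\mathfrak a$ has full rank in $\mathfrak a$ and put $\Gamma_{\mathfrak t}=\pi(\Gamma_{\mathfrak g})$. Let $\Gamma^*_{\mathfrak a},\Gamma_{\mathfrak t}^*$ be the dual lattices, $\mu:\mathfrak g^*\to\mathfrak a^*$ the dual map, $(\omega^i)$ the dual basis, $\alpha_i=\mu(\omega^i)$, $\beta_i=\pi(\omega_i)$, $\mathfrak A=[\alpha_1,\dots,\alpha_n]$, $\mathfrak B=[\beta_1,\dots,\beta_n]$; the $\alpha_i$ generate $\Gamma_{\mathfrak a}^*$ over $\mathbb Z$. $\mathfrak A$ is projective if it lies in an open (linear) half space of $\mathfrak a^*$; it is spanning if for every $k$ the vector $\kappa=\sum_i\alpha_i$ can be written $\kappa=\sum_i t_i\alpha_i$ with $t_i\ge0$, $t_k=0$, $t_i\ne0$ for $i\neq k$. $\mathfrak a_{\mathbb C}$ is embedded in $\mathfrak g_{\mathbb C}\cong\mathbb C^n$ by $u\mapsto(\alpha_1(u),\dots,\alpha_n(u))$, and $U(\mathfrak A)=\{u\in\mathfrak a_{\mathbb C}:\alpha_i(u)\ne0\ \forall i\}$. For $\beta\in\Gamma_{\mathfrak t}$,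 $w\in T$, $e_\beta(w)=e^{2\pi\sqrt{-1}\langle w,\beta\rangle}$. For a $\mathbb Z$-basis $(h_1,\dots,h_d)$ of $\Gamma_{\mathfrak t}^*$, $O_{\mathfrak B}(z)=\{w\in T:\ \sum_iz_i\langle h_k,\beta_i\rangle e_{\beta_i}(w)=0,\ k=1,\dots,d\}$. *)

(* Defs.v *)
From HB Require Import structures.
From mathcomp Require Import all_boot all_order all_algebra.
From mathcomp Require Import generic_quotient ring_quotient.
From mathcomp Require Import complex ring lra.
From mathcomp Require Import boolp classical_sets reals sequences exp trigo.

Set Implicit Arguments.
Unset Strict Implicit.
Unset Printing Implicit Defensive.

Import Order.TTheory GRing.Theory Num.Theory.
Local Open Scope classical_set_scope.
Local Open Scope complex_scope.
Local Open Scope quotient_scope.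
Local Open Scope ring_scope.

Section Lattices.

Definition Zspan (V : zmodType) (m : nat) (b : 'I_m -> V) : set V :=
  [set v | exists c : 'I_m -> int, v = \sum_i b i *~ c i].

Definition Zbasis (V : zmodType) (L : set V) (m : nat) (b : 'I_m -> V) : Prop :=
  L = Zspan b /\
  forall c : 'I_m -> int, \sum_i b i *~ c i = 0 -> forall i, c i = 0.

Variable R : realType.

Definition full_rank (V : vectType R) (L : set V) : Prop :=
  exists s : seq V, (forall x, x \in s -> L x) /\ <<s>>%VS = fullv.

Definition dual_lattice (V : vectType R) (L : set V) : set 'Hom(V, R^o) :=
  [set f : 'Hom(V, R^o) | forall x, L x -> f x \is a Num.int].

Definition short_exact (a g t : vectType R)
    (iota : 'Hom(a, g)) (prj : 'Hom(g, t)) : Prop :=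
  [/\ lker iota = 0%VS, limg iota = lker prj & limg prj = fullv].

End Lattices.

Section Complexification.

Variable R : realType.

(* (x, y) stands for x + i y. *)
Definition cplx (V : vectType R) : zmodType := (V * V)%type.

(* The C-bilinear extension of the pairing between V^* and V, restricted to
   V^* x V_C and to (V^* )_C x V respectively; (V_C)^* is identified with
   (V^* )_C. *)
Definition evC (V : vectType R) (f : 'Hom(V, R^o)) (u : cplx V) : R[i] :=
  f u.1 +i* f u.2.

Definition dual_evC (V : vectType R) (w : cplx 'Hom(V, R^o)) (v : V) : R[i] :=
  w.1 v +i* w.2 v.

Definition cexp (x : R[i]) : R[i] :=
  (expR (complex.Re x))%:C * (cos (complex.Im x) +i* sin (complex.Im x)).

Lemma cexpD x y : cexp (x + y) = cexp x * cexp y.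
Proof.
case: x => a b; case: y => c d; rewrite /cexp /= expRD cosD sinD.
by apply/eqP; rewrite eq_complex /=; apply/andP; split; apply/eqP; ring.
Qed.

Lemma cexp0 : cexp 0 = 1.
Proof. by rewrite /cexp /= expR0 cos0 sin0 mul1r. Qed.

Lemma cexp_neq0 x : cexp x != 0.
Proof.
apply/eqP => x0; have := cexpD x (- x).
by rewrite subrr cexp0 x0 mul0r; apply/eqP; rewrite oner_eq0.
Qed.

Lemma cexp_int (m : int) : cexp ((pi *+ 2)%:C * 'i%C * (m%:~R)%:C) = 1.
Proof.
have H (k : nat) : cexp ((pi *+ 2)%:C * 'i%C * (k%:R)%:C) = 1.
  rewrite /cexp /= !(mulr0, mul0r, mulr1, mul1r, subr0, addr0, add0r, oppr0).
  rewrite expR0 mul1r -[X in cos X]add0r -[X in sin X]add0r mulr_natr.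
  by rewrite (periodicn (@cosD2pi R)) (periodicn (@sinD2pi R)) cos0 sin0.
case: m => k; first exact: H.
have := cexpD ((pi *+ 2)%:C * 'i%C * (k.+1%:R)%:C)
              (- ((pi *+ 2)%:C * 'i%C * (k.+1%:R)%:C)).
rewrite subrr cexp0 H mul1r NegzE mulrNz => ->.
by rewrite raddfN /= mulrN.
Qed.

Lemma cos_eq1_int (y : R) : cos (pi *+ 2 * y) = 1 -> y \is a Num.int.
Proof.
move=> cy; set m := Num.floor y; set f := y - m%:~R.
have f0 : 0 <= f by rewrite subr_ge0 floor_le.
have f1 : f < 1 by rewrite ltrBlDl -[X in _ + X]/(1%:~R) -intrD floorD1_gt.
have cf : cos (pi *+ 2 * f) = 1.
  have := cexpD ((pi *+ 2)%:C * 'i%C * f%:C)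
                ((pi *+ 2)%:C * 'i%C * (m%:~R)%:C).
  rewrite cexp_int mulr1 -mulrDr -rmorphD /= /f subrK => /(congr1 (@complex.Re R)).
  rewrite /cexp /= !(mulr0, mul0r, mulr1, mul1r, subr0, addr0, add0r, oppr0).
  by rewrite expR0 !mul1r cy.
suff f00 : f = 0 by apply/intrP; exists m; apply: subr0_eq.
apply/eqP; rewrite eq_sym -[_ == _]negbK -[_ != _]andbT -f0 -lt_neqAle.
apply/negP => fp.
have : sin (pi * f) ^+ 2 = 0.
  by move: cf; rewrite mulrnAl cos_mulr2n cos2sin2; lra.
move/eqP; rewrite sqrf_eq0 gt_eqF // sin_gt0_pi // mulr_gt0 ?pi_gt0 //=.
by rewrite -[ltRHS]mulr1 ltr_pM2l ?pi_gt0.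
Qed.

Lemma cexp_eq1_int (x y : R) :
  cexp ((pi *+ 2)%:C * 'i%C * (x +i* y)) = 1 -> x \is a Num.int /\ y = 0.
Proof.
rewrite /cexp /= !(mulr0, mul0r, mulr1, mul1r, oppr0, subr0, addr0, add0r, sub0r).
set E := expR _; move/eqP; rewrite eq_complex /= !mul0r subr0 addr0.
move=> /andP[/eqP Ec /eqP Es].
have E0 : 0 < E by exact: expR_gt0.
have s0 : sin (pi *+ 2 * x) = 0.
  by apply/eqP; move/eqP: Es; rewrite mulf_eq0 gt_eqF.
have E1 : E = 1.
  have := normrM E (cos (pi *+ 2 * x)).
  by rewrite Ec (sin0cos1 s0) mulr1 normr1 gtr0_norm.
split; first by apply: cos_eq1_int; rewrite -Ec E1 mul1r.
move/eqP: E1; rewrite -expR0 (inj_eq (@expR_inj R)) oppr_eq0 mulf_eq0.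
by rewrite mulrn_eq0 /= gt_eqF ?pi_gt0 //= => /eqP.
Qed.

End Complexification.

Section Configuration.

Variables (R : realType) (n : nat) (a g t : vectType R).
Variables (iota : 'Hom(a, g)) (prj : 'Hom(g, t)) (omega : n.-tuple g).

Definition Gamma_g : set g := Zspan (fun i : 'I_n => omega`_i).

Definition Gamma_a : set a := iota @^-1` Gamma_g.

Definition Gamma_t : set t := prj @` Gamma_g.

Definition mu (f : 'Hom(g, R^o)) : 'Hom(a, R^o) := (f \o iota)%VF.

Definition omega_dual (i : 'I_n) : 'Hom(g, R^o) :=
  linfun (coord omega i : g -> R^o).

Definition alpha (i : 'I_n) : 'Hom(a, R^o) := mu (omega_dual i).

Definition beta (i : 'I_n) : t := prj omega`_i.

Definition projective : Prop :=
  exists l : 'Hom('Hom(a, R^o), R^o), l != 0 /\ forall i, 0 < l (alpha i).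

Definition kappa : 'Hom(a, R^o) := \sum_i alpha i.

Definition spanning : Prop :=
  forall k : 'I_n, exists tt : 'I_n -> R,
    [/\ kappa = \sum_i tt i *: alpha i,
        forall i, 0 <= tt i, tt k = 0 & forall i, i != k -> tt i != 0].

Definition alphaC (u : cplx a) : 'rV[R[i]]_n := \row_i evC (alpha i) u.

Definition U_A : set (cplx a) := [set u | forall i, evC (alpha i) u != 0].

(* For lambda in Gamma_a the number alpha_i(lambda) is an integer, see
   alpha_lamE below, so that the floor only changes its type. *)
Definition alpha_lam (i : 'I_n) (lambda : a) : int :=
  Num.floor (alpha i lambda).

Definition p_fun (lambda : a) (u : cplx a) : R[i] :=
  \prod_i evC (alpha i) u ^ alpha_lam i lambda.

Definition q_val (lambda : a) (z : 'rV[R[i]]_n) : R[i] :=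
  \prod_i z 0 i ^ alpha_lam i lambda.

(* The dual lattice of Gamma_t, inside the real part of (t^* )_C. *)
Definition Gamma_t_dual : {pred cplx 'Hom(t, R^o)} :=
  fun w => `[< dual_lattice Gamma_t w.1 >] && (w.2 == 0).

Lemma Gamma_t_dual_zmod_closed : zmod_closed Gamma_t_dual.
Proof.
split=> [|u v].
  apply/andP; split => //; apply/asboolP => x _.
  by rewrite lfunE rpred0.
move=> /andP[/asboolP u1 /eqP u2] /andP[/asboolP v1 /eqP v2].
apply/andP; split; last by rewrite /= u2 v2 subrr.
apply/asboolP => x Lx /=; rewrite !lfunE /= lfunE /=.
by rewrite rpredB ?u1 ?v1.
Qed.

HB.instance Definition _ :=
  GRing.isZmodClosed.Build (cplx 'Hom(t, R^o)) Gamma_t_dual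
    Gamma_t_dual_zmod_closed.

Definition torus := Quotient.quot Gamma_t_dual.

(* For b in Gamma_t this does not depend on the representative, see e_pi
   below. *)
Definition e_ (b : t) (w : torus) : R[i] :=
  cexp ((pi *+ 2)%:C * 'i%C * dual_evC (repr w) b).

Definition O_B (d : nat) (h : 'I_d -> 'Hom(t, R^o)) (z : 'rV[R[i]]_n) :
    set torus :=
  [set w | forall k, \sum_i z 0 i * (h k (beta i))%:C * e_ (beta i) w = 0].

Definition torus_emb (z : 'rV[R[i]]_n) (w : torus) : 'rV[R[i]]_n :=
  \row_i (z 0 i * e_ (beta i) w).

Lemma alpha_lamE (i : 'I_n) (lambda : a) :
  basis_of {:g} omega -> Gamma_a lambda ->
  (alpha_lam i lambda)%:~R = alpha i lambda.
Proof.
move=> bas [c lamE]; suff /intrP[m mE] : alpha i lambda \is a Num.int.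
  by rewrite /alpha_lam mE intrKfloor.
rewrite /alpha /mu /omega_dual comp_lfunE lfunE /= lamE linear_sum /=.
apply: rpred_sum => j _.
by rewrite raddfMz /= coord_free ?(basis_free bas) // rpredMz // rpred_nat.
Qed.

Lemma alphaC_inj :
  lker iota = 0%VS -> basis_of {:g} omega -> injective alphaC.
Proof.
move=> ker0 bas [x y] [x' y'] /rowP H.
have iota_inj : injective iota by apply/lker0P/eqP.
have E i : coord omega i (iota x) = coord omega i (iota x') /\
           coord omega i (iota y) = coord omega i (iota y').
  move: (H i); rewrite !mxE /evC /alpha /mu /omega_dual !comp_lfunE !lfunE /=.
  by case.
congr pair; apply: iota_inj;
  rewrite [LHS](coord_basis bas (memvf _)) [RHS](coord_basis bas (memvf _));
  by apply: eq_bigr => i _; rewrite ?(E i).1 ?(E i).2.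
Qed.

Lemma cexp_congr (b : t) (w w' : cplx 'Hom(t, R^o)) :
  Gamma_t b -> w - w' \in Gamma_t_dual ->
  cexp ((pi *+ 2)%:C * 'i%C * dual_evC w b) =
  cexp ((pi *+ 2)%:C * 'i%C * dual_evC w' b).
Proof.
move=> Gb /andP[/asboolP w1 /eqP w2].
have /intrP[m mE] := w1 _ Gb.
have -> : dual_evC w b = dual_evC w' b + (m%:~R)%:C.
  rewrite -mE /dual_evC /= !lfunE /= lfunE /=.
  move/subr0_eq: w2 => ->; apply/eqP; rewrite eq_complex /= addr0 eqxx andbT.
  by apply/eqP; ring.
by rewrite mulrDr cexpD cexp_int mulr1.
Qed.

Lemma e_pi (b : t) (w : cplx 'Hom(t, R^o)) :
  Gamma_t b ->
  e_ b (\pi_torus w) = cexp ((pi *+ 2)%:C * 'i%C * dual_evC w b).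
Proof.
move=> Gb; apply: cexp_congr => //.
by rewrite Quotient.idealrBE reprK.
Qed.

Lemma torus_emb_inj (z : 'rV[R[i]]_n) :
  limg prj = fullv -> basis_of {:g} omega -> (forall i, z 0 i != 0) ->
  injective (torus_emb z).
Proof.
move=> sprj bas z0 v w /rowP vw.
rewrite -[v]reprK -[w]reprK; apply/eqP; rewrite -Quotient.idealrBE.
set x := repr v; set y := repr w.
have H i : (x.1 - y.1) (beta i) \is a Num.int /\ (x.2 - y.2) (beta i) = 0.
  move: (vw i); rewrite !mxE => /(mulfI (z0 i)) exy.
  apply: cexp_eq1_int; apply: (mulIf (cexp_neq0 ((pi *+ 2)%:C * 'i%C * dual_evC y (beta i)))).
  rewrite mul1r -cexpD -mulrDr -[RHS]exy; congr (cexp (_ * _)).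
  rewrite /dual_evC !lfunE /= !lfunE /=.
  by apply/eqP; rewrite eq_complex /= !subrK !eqxx.
have om u : u = \sum_i coord omega i u *: omega`_i.
  exact: coord_basis bas (memvf u).
apply/andP; split.
  apply/asboolP => _ [_ [c ->] <-]; rewrite !linear_sum rpred_sum // => i _.
  by rewrite !raddfMz rpredMz //; exact: (H i).1.
apply/eqP/lfunP => u; have : u \in limg prj by rewrite sprj memvf.
move/memv_imgP => [s _ ->]; rewrite [RHS]lfunE (om s) !linear_sum /= [RHS]big1_eq big1 // => i _.
by rewrite !linearZ /= (H i).2 scaler0.
Qed.

End Configuration.

(* Main.v *)
Require Import Defs.
From mathcomp Require Import all_boot all_order all_algebra.
From mathcomp Require Import complex ring lra.
From mathcomp Require Import boolp classical_sets reals exp trigo.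

Set Implicit Arguments.
Unset Strict Implicit.

Import Order.TTheory GRing.Theory Num.Theory.
Local Open Scope classical_set_scope.
Local Open Scope complex_scope.
Local Open Scope ring_scope.

(** Write A for the integer n x r matrix of the numbers <alpha_i, lambda_j>, so
    that u |-> (alpha_i(u)) identifies a_C with the column space of A.  Both
    inclusions come from one arithmetic fact: since Gamma_a is all of the
    lattice of g lying in a, the lattice spanned by the columns of A is
    saturated in Z^n, and hence A has an integral left inverse B
    ([saturated_left_inverse], [alpha_matrix_left_inverse]).

    The identity B A = 1 has two consequences.  First, 1 - A B is an integral
    matrix that kills the columns of A, and y = A (B y) as soon as
    (1 - A B) y = 0; so y lies in a_C as soon as it satisfies every integral
    linear relation satisfied by the columns of A ([alphaC_image]).  Those
    relations are the elements of the lattice dual to Gamma_t, so the d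
    equations that define O_B(z) generate them ([critical_relations]).
    Secondly, m |-> m A maps Z^n onto Z^r ([alpha_unimodular]), which says that
    the alpha_i generate the dual of Gamma_a.  Hence a point c of the
    algebraic torus (C^* )^n with prod_i c_i ^ A_ij = 1 for all j comes from T:
    if c_i = exp(2 pi i l_i), the numbers sum_i l_i A_ij are integers, and
    changing the l_i by suitable integers makes them all vanish; then l is a
    linear form on g_C that is zero on a_C, that is, an element of the complex
    dual of t ([torus_point_of_monomials]).  Conversely the monomials
    prod_i e_(beta_i) ^ A_ij are 1 on T because sum_i A_ij beta_i is the image
    in t of an element of a ([torus_monomials]).

    Granting this, a point y = (z_i e_(beta_i)(w)) of O_B(z) lies in a_C, has
    nonzero coordinates, and satisfies p_j = q_j since y_i / z_i has trivial
    monomials.  In the other direction the equations p_j = q_j say that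
    alpha_i(u) / z_i has trivial monomials, which gives w, and the equations of
    O_B(z) hold because sum_i alpha_i(u) beta_i = 0. *)

(** * Saturated lattices *)

(** In Smith normal form L D Q, injectivity makes every diagonal entry nonzero
    and saturation makes it invertible: e_j times the j-th column of L is a column
    of A Q^-1, so the j-th column of L is already in the image of A, and e_j
    divides a column of the unimodular matrix Q^-1. *)
Lemma saturated_left_inverse {n r : nat} (A : 'M[int]_(n, r)) :
  (forall x : 'cV_r, A *m x = 0 -> x = 0) ->
  (forall (v : 'cV_n) (x : 'cV_r) (N : int),
     N != 0 -> N *: v = A *m x -> exists x', v = A *m x') ->
  exists B : 'M_(r, n), B *m A = 1%:M.
Proof.
move=> injA satA.
have [L Lu [Q Qu [e _ AE]]] := int_Smith_normal_form A.
set D := \matrix_(i, j) _ in AE.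
have AcolQ (j : 'I_r) : A *m col j (invmx Q) = L *m col j D.
  by rewrite !colE !mulmxA AE mulmxK.
(* Columns of a unimodular matrix are primitive: c can only be a unit. *)
have invQ_primitive (j : 'I_r) (x : 'cV_r) c :
    col j (invmx Q) = c *: x -> exists y, c * y = 1.
  move/(congr1 (mulmx Q)); rewrite colE mulmxA mulmxV // mul1mx -scalemxAr.
  move/matrixP/(_ j 0); rewrite mxE [RHS]mxE !eqxx => ?.
  by exists ((Q *m x) j 0).
have e_unit (j : 'I_r) : (j < n)%N /\ e`_j \is a GRing.unit.
  have [jn|jn] := ltnP j n; last first.
    have D0 : col j D = 0.
      apply/colP => i; rewrite !mxE; case: eqP => // ij.
      by have := ltn_ord i; rewrite ij ltnNge jn.
    have := AcolQ j; rewrite D0 mulmx0 => /injA; rewrite -(scale0r 0).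
    by case/invQ_primitive => y; rewrite mul0r.
  have De : col j D = e`_j *: delta_mx (Ordinal jn) 0.
    apply/colP => i; rewrite !mxE andbT -val_eqE /=.
    by case: eqP => [->|_]; rewrite ?mulr1 ?mulr0.
  split=> //; have [e0|e0] := eqVneq e`_j 0.
    have := AcolQ j; rewrite De e0 scale0r mulmx0 => /injA; rewrite -(scale0r 0).
    by case/invQ_primitive => y; rewrite mul0r.
  have := AcolQ j; rewrite De -scalemxAr => /esym Le.
  have [x Lx] := satA _ _ _ e0 Le.
  have : col j (invmx Q) = e`_j *: x.
    apply/eqP; rewrite -subr_eq0; apply/eqP/injA.
    by rewrite mulmxBr -Le Lx -scalemxAr subrr.
  by case/invQ_primitive => y ey; apply/unitrPr; exists y.
pose D' : 'M_(r, n) := \matrix_(j, i) ((e`_j)^-1 *+ (i == j :> nat)).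
have D'D : D' *m D = 1%:M.
  apply/matrixP => j k; have [jn eu] := e_unit j.
  rewrite !mxE (bigD1 (Ordinal jn)) //= big1 => [|i ij].
    rewrite !mxE /= eqxx mulr1n addr0 -[in RHS]val_eqE /=.
    by case: eqP; rewrite ?mulr1n ?mulr0n ?mulVr ?mulr0.
  by rewrite !mxE -val_eqE /= in ij *; rewrite (negPf ij) mulr0n mul0r.
exists (invmx Q *m D' *m invmx L).
by rewrite AE !mulmxA mulmxKV // -(mulmxA _ D') D'D mulmx1 mulVmx.
Qed.

Lemma hom_descends {K : fieldType} {g t s : vectType K}
    (prj : 'Hom(g, t)) (f : 'Hom(g, s)) :
  limg prj = fullv -> (forall x, x \in lker prj -> f x = 0) ->
  exists fbar : 'Hom(t, s), forall x, fbar (prj x) = f x.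
Proof.
move=> onto vanish; exists (f \o prj^-1)%VF => x; rewrite comp_lfunE.
apply/eqP; rewrite -subr_eq0 -linearB; apply/eqP/vanish.
by rewrite memv_ker linearB /= limg_lfunVK ?subrr // onto memvf.
Qed.

Lemma Zspan_mem {V : zmodType} {m : nat} (b : 'I_m -> V) j : Zspan b (b j).
Proof.
exists (fun k => (k == j : nat)%:Z).
rewrite (bigD1 j) //= eqxx mulr1z big1 ?addr0 // => k kj.
by rewrite (negPf kj) mulr0z.
Qed.

(** * The complex exponential *)

Section Exponential.
Variable R : realType.
Implicit Types (c w : R[i]) (x y : R).

Let tau : R[i] := (pi *+ 2)%:C * 'i%C.

Lemma cos_sin_surj x y :
  x ^+ 2 + y ^+ 2 = 1 -> exists s : R, cos s = x /\ sin s = y.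
Proof.
move=> xy1; have x1 : -1 <= x <= 1 by apply/andP; split; nra.
have sE : sin (acos x) = `|y|.
  by rewrite sin_acos // -sqrtr_sqr; congr Num.sqrt; lra.
have cE : cos (acos x) = x by apply: acosK; rewrite in_itv.
have [y0|y0] := leP 0 y; first by exists (acos x); rewrite sE ger0_norm.
by exists (- acos x); rewrite cosN sinN sE ltr0_norm ?opprK.
Qed.

Lemma cexp_2pii_surj c : c != 0 -> exists w, c = cexp (tau * w).
Proof.
case: c => x y c0.
have n0 : 0 < x ^+ 2 + y ^+ 2.
  rewrite lt_def addr_ge0 ?sqr_ge0 // andbT paddr_eq0 ?sqr_ge0 // !sqrf_eq0.
  by move: c0; rewrite eq_complex.
set rho := Num.sqrt (x ^+ 2 + y ^+ 2).
have rho0 : 0 < rho by rewrite sqrtr_gt0.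
have rhoE : rho ^+ 2 = x ^+ 2 + y ^+ 2 by rewrite sqr_sqrtr // ltW.
have [] := @cos_sin_surj (x / rho) (y / rho).
  by rewrite !expr_div_n -mulrDl -rhoE divff // sqrf_eq0 gt_eqF.
move=> s [cs sn]. have : (pi *+ 2 : R) != 0 by rewrite mulrn_eq0 /= gt_eqF ?pi_gt0.
rewrite /tau; move: (pi *+ 2) => p p0.
exists ((s / p) +i* (- (ln rho / p))).
have -> : p%:C * 'i%C * ((s / p) +i* (- (ln rho / p))) = ln rho +i* s.
  move: (ln rho) => l; apply/eqP; rewrite eq_complex /=.
  by apply/andP; split; apply/eqP; field.
rewrite /cexp /= lnK ?posrE // cs sn.
by apply/eqP; rewrite eq_complex /=; apply/andP; split; apply/eqP;
  field; rewrite gt_eqF.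
Qed.

Lemma cexpMz w (m : int) : cexp (w *~ m) = cexp w ^ m.
Proof.
have nat_case (k : nat) : cexp (w *+ k) = cexp w ^+ k.
  by elim: k => [|k IH]; rewrite ?cexp0 // mulrS exprS cexpD IH.
case: m => k; first exact: nat_case.
rewrite NegzE mulrNz -exprnN -nat_case.
apply: (mulIf (cexp_neq0 (w *~ k.+1))).
by rewrite -cexpD addNr cexp0 mulVf ?cexp_neq0.
Qed.

Lemma prod_cexp {I : finType} (w : I -> R[i]) (m : I -> int) :
  \prod_i cexp (tau * w i) ^ m i = cexp (tau * \sum_i w i *~ m i).
Proof.
rewrite mulr_sumr (big_morph _ (@cexpD R) (@cexp0 R)).
by apply: eq_bigr => i _; rewrite -cexpMz mulrzAr.
Qed.

End Exponential.

(** * The lattice of a and the torus T *)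

Section Lattice.
Variables (R : realType) (n r : nat) (a g t : vectType R).
Variables (iota : 'Hom(a, g)) (prj : 'Hom(g, t)) (omega : n.-tuple g).
Hypothesis ker0 : lker iota = 0%VS.
Hypothesis im_ker : limg iota = lker prj.
Hypothesis onto : limg prj = fullv.
Hypothesis omega_basis : basis_of {:g} omega.
Hypothesis Gamma_a_full : full_rank (Gamma_a iota omega).
Variable lambda : 'I_r -> a.
Hypothesis lambda_basis : Zbasis (Gamma_a iota omega) lambda.

Let A : 'M[int]_(n, r) := \matrix_(i, j) alpha_lam iota omega i (lambda j).

Lemma lambda_Gamma_a j : Gamma_a iota omega (lambda j).
Proof. by rewrite lambda_basis.1; exact: Zspan_mem. Qed.

Lemma alpha_coord i x : alpha iota omega i x = coord omega i (iota x).
Proof. by rewrite /alpha /mu /omega_dual comp_lfunE lfunE. Qed.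

Lemma alpha_inj x y :
  (forall i, alpha iota omega i x = alpha iota omega i y) -> x = y.
Proof.
move=> xy; have iota_inj : injective iota by apply/lker0P/eqP.
apply: iota_inj; rewrite (coord_basis omega_basis (memvf (iota x))).
rewrite [RHS](coord_basis omega_basis (memvf _)); apply: eq_bigr => i _.
by rewrite -!alpha_coord xy.
Qed.

Lemma iota_Gamma_a x : Gamma_a iota omega x ->
  iota x = \sum_(i < n) omega`_i *~ alpha_lam iota omega i x.
Proof.
move=> Gx; rewrite {1}(coord_basis omega_basis (memvf (iota x))).
by apply: eq_bigr => i _; rewrite -alpha_coord -alpha_lamE // scaler_int.
Qed.

Lemma alpha_Zcomb i (x : 'cV[int]_r) :
  alpha iota omega i (\sum_j lambda j *~ x j 0) = ((A *m x) i 0)%:~R.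
Proof.
rewrite linear_sum mxE rmorph_sum; apply: eq_bigr => j _ /=.
by rewrite raddfMz /= -alpha_lamE ?mxE ?rmorphM /= ?mulrzr //; exact: lambda_Gamma_a.
Qed.

(** The columns of A span a saturated lattice: if N v = A x, then
    X = N^-1 sum_j x_j lambda_j is a vector of a with integral coordinates v in
    g, hence an element of Gamma_a and an integral combination of the
    lambda_j. *)
Lemma alpha_matrix_left_inverse : exists B : 'M[int]_(r, n), B *m A = 1%:M.
Proof.
apply: saturated_left_inverse => [x Ax|v x N N0 NvAx].
  apply/colP => j; rewrite [RHS]mxE; move: j.
  apply: (lambda_basis.2 (fun j => x j 0)); apply: alpha_inj => i.
  by rewrite alpha_Zcomb Ax mxE linear0.
have NR0 : (N%:~R : R) != 0 by rewrite intr_eq0.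
pose X := (N%:~R)^-1 *: \sum_j lambda j *~ x j 0.
have XE i : alpha iota omega i X = (v i 0)%:~R.
  rewrite linearZ /= alpha_Zcomb -NvAx mxE rmorphM /=.
  by rewrite [LHS]mulKf.
have : Gamma_a iota omega X.
  exists (fun i => v i 0); rewrite (coord_basis omega_basis (memvf (iota X))).
  by apply: eq_bigr => i _; rewrite -alpha_coord XE scaler_int.
rewrite lambda_basis.1 => -[c Xc].
exists (\col_j c j); apply/colP => i; apply: (@intr_inj R).
rewrite -XE -alpha_Zcomb Xc; congr (alpha _ _ _ _).
by apply: eq_bigr => j _; rewrite mxE.
Qed.

(** In invariant terms: the alpha_i generate the dual lattice of Gamma_a. *)
Lemma alpha_unimodular (N : 'I_r -> int) : exists m : 'I_n -> int,
  forall j, \sum_i m i * alpha_lam iota omega i (lambda j) = N j.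
Proof.
have [B BA] := alpha_matrix_left_inverse.
exists (fun i => ((\row_j N j) *m B) 0 i) => j.
have : ((\row_j N j) *m B *m A) 0 j = N j by rewrite -mulmxA BA mulmx1 mxE.
by rewrite mxE => <-; apply: eq_bigr => i _; rewrite [A i j]mxE.
Qed.

(** The rows of 1 - A B are integral relations between the columns of A, and
    (1 - A B) y = 0 exhibits y as A (B y). *)
Lemma alpha_image (y : 'I_n -> R) :
  (forall c : 'I_n -> int,
     (forall j, \sum_i c i * alpha_lam iota omega i (lambda j) = 0) ->
     \sum_i y i *~ c i = 0) ->
  exists x, forall i, alpha iota omega i x = y i.
Proof.
move=> ann; have [B BA] := alpha_matrix_left_inverse.
pose P := 1%:M - A *m B.
have PA : P *m A = 0 by rewrite mulmxBl mul1mx -mulmxA BA mulmx1 subrr.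
pose BR : 'M[R]_(r, n) := map_mx intr B.
pose yc : 'cV[R]_n := \col_i y i.
exists (\sum_j (BR *m yc) j 0 *: lambda j) => i.
have -> : alpha iota omega i (\sum_j (BR *m yc) j 0 *: lambda j) =
          (map_mx intr A *m (BR *m yc)) i 0.
  rewrite linear_sum mxE; apply: eq_bigr => j _.
  rewrite linearZ /= -alpha_lamE //; last exact: lambda_Gamma_a.
  by rewrite !mxE [LHS]mulrC.
rewrite mulmxA -map_mxM; apply/eqP; rewrite eq_sym -subr_eq0; apply/eqP.
have -> : y i = yc i 0 by rewrite mxE.
have -> : A *m B = 1%:M - P by rewrite opprB addrC subrK.
rewrite map_mxB map_mx1 mulmxBl mul1mx [X in _ - X]mxE opprD addrA subrr add0r.
rewrite 2!mxE opprK; under eq_bigr do rewrite [_ i _]mxE [yc _ 0]mxE mulrzl.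
apply: (ann (P i)) => j.
have : (P *m A) i j = 0 by rewrite PA mxE.
by rewrite mxE => {2}<-; apply: eq_bigr => k _; rewrite [A k j]mxE.
Qed.

(** The form on g with coordinates c vanishes on the lambda_j, which span a
    because Gamma_a has full rank, and so descends to g / a = t. *)
Lemma functional_on_t (c : 'I_n -> R) :
  (forall j, \sum_i c i *~ alpha_lam iota omega i (lambda j) = 0) ->
  exists f : 'Hom(t, R^o), forall i, f (beta prj omega i) = c i.
Proof.
move=> cA.
pose phi : 'Hom(g, R^o) := \sum_i (c i : R) *: omega_dual omega i.
have phiE (i : 'I_n) : phi omega`_i = c i.
  rewrite sum_lfunE (bigD1 i) //= big1 => [|k ki].
    rewrite lfunE /= lfunE /= coord_free ?(basis_free omega_basis) // eqxx.
    by rewrite addr0 [LHS]mulr1.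
  rewrite lfunE /= lfunE /= coord_free ?(basis_free omega_basis) //.
  by rewrite eq_sym (negPf ki) scaler0.
have phi_lambda j : phi (iota (lambda j)) = 0.
  rewrite iota_Gamma_a; last exact: lambda_Gamma_a.
  by rewrite linear_sum -[RHS](cA j); apply: eq_bigr => i _; rewrite raddfMz /= phiE.
have phi_a : lker (phi \o iota)%VF = fullv.
  have [s [sG s_span]] := Gamma_a_full; apply/eqP; rewrite eqEsubv subvf -s_span /=.
  apply/span_subvP => x /sG; rewrite lambda_basis.1 => -[m ->].
  rewrite memv_ker linear_sum big1 // => j _.
  by rewrite raddfMz /= comp_lfunE phi_lambda mul0rz.
have [] := hom_descends (f := phi) onto.
  move=> x; rewrite -im_ker => /memv_imgP[x' _ ->].
  by apply/eqP; rewrite -comp_lfunE -memv_ker phi_a memvf.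
by move=> f fE; exists f => i; rewrite fE.
Qed.


Lemma sum_alpha_beta x : \sum_i alpha iota omega i x *: beta prj omega i = 0.
Proof.
transitivity (prj (iota x)); last first.
  by apply/eqP; rewrite -memv_ker -im_ker memv_img ?memvf.
rewrite (coord_basis omega_basis (memvf (iota x))) linear_sum.
by apply: eq_bigr => i _; rewrite linearZ alpha_coord.
Qed.

Lemma dual_evC_Zcomb (w : cplx 'Hom(t, R^o)) (m : 'I_n -> int) :
  dual_evC w (\sum_i beta prj omega i *~ m i) =
  \sum_i dual_evC w (beta prj omega i) *~ m i.
Proof.
apply/eqP; rewrite eq_complex; apply/andP; split; apply/eqP.
  rewrite (raddf_sum (@complex.Re R)) /= linear_sum.
  by apply: eq_bigr => i _; rewrite !raddfMz.
rewrite (raddf_sum (@complex.Im R)) /= linear_sum.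
by apply: eq_bigr => i _; rewrite !raddfMz.
Qed.

Lemma sum_beta_lambda j :
  \sum_i beta prj omega i *~ alpha_lam iota omega i (lambda j) = 0.
Proof.
rewrite -[RHS](sum_alpha_beta (lambda j)); apply: eq_bigr => i _.
by rewrite -alpha_lamE ?scaler_int //; exact: lambda_Gamma_a.
Qed.

Lemma alphaC_image (y : 'I_n -> R[i]) :
  (forall c : 'I_n -> int,
     (forall j, \sum_i c i * alpha_lam iota omega i (lambda j) = 0) ->
     \sum_i y i *~ c i = 0) ->
  exists u : cplx a, forall i, evC (alpha iota omega i) u = y i.
Proof.
move=> ann.
have [c cA|x xE] := alpha_image (y := fun i => complex.Re (y i)).
  transitivity (complex.Re (\sum_i y i *~ c i)); last by rewrite ann.
  rewrite (raddf_sum (@complex.Re R)).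
  by apply: eq_bigr => i _; rewrite raddfMz.
have [c cA|x' xE'] := alpha_image (y := fun i => complex.Im (y i)).
  transitivity (complex.Im (\sum_i y i *~ c i)); last by rewrite ann.
  rewrite (raddf_sum (@complex.Im R)).
  by apply: eq_bigr => i _; rewrite raddfMz.
exists (x, x') => i; rewrite /evC xE xE'.
by apply/eqP; rewrite eq_complex !eqxx.
Qed.

(** An integral relation c between the columns of A is a linear form on t that
    is integral on Gamma_t, hence an integral combination of the h_k. *)
Lemma critical_relations {d : nat} (h : 'I_d -> 'Hom(t, R^o)) (y : 'I_n -> R[i]) :
  Zbasis (dual_lattice (Gamma_t prj omega)) h ->
  (forall k, \sum_i y i * (h k (beta prj omega i))%:C = 0) ->
  forall c : 'I_n -> int,
    (forall j, \sum_i c i * alpha_lam iota omega i (lambda j) = 0) ->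
    \sum_i y i *~ c i = 0.
Proof.
move=> h_basis crit c cA.
have [j|f fE] := functional_on_t (c := fun i => (c i)%:~R).
  rewrite -[RHS](rmorph0 (intr : int -> R)) -(cA j) rmorph_sum.
  by apply: eq_bigr => i _; rewrite rmorphM /= mulrzr.
have : dual_lattice (Gamma_t prj omega) f.
  move=> _ [_ [m ->] <-]; rewrite !linear_sum rpred_sum // => i _.
  by rewrite !raddfMz rpredMz //= [f _]fE intr_int.
rewrite h_basis.1 => -[m fh].
have -> : \sum_i y i *~ c i =
          \sum_i \sum_k (y i * (h k (beta prj omega i))%:C) *~ m k.
  apply: eq_bigr => i _.
  have -> : y i *~ c i = y i * (f (beta prj omega i))%:C.
    by rewrite fE rmorph_int mulrzr.
  rewrite fh sum_lfunE rmorph_sum mulr_sumr; apply: eq_bigr => k _ /=.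
  by rewrite -scaler_int lfunE /= -mulrzAr -rmorphMz; congr (_ * (_)%:C); exact: mulrzl.
rewrite exchange_big big1 // => k _ /=.
by rewrite -mulrz_suml crit mul0rz.
Qed.

Lemma torus_monomials (w : torus prj omega) j :
  \prod_i e_ (beta prj omega i) w ^ alpha_lam iota omega i (lambda j) = 1.
Proof.
rewrite prod_cexp -dual_evC_Zcomb sum_beta_lambda.
by case: (repr w) => f1 f2; rewrite /dual_evC /= !linear0 mulr0 cexp0.
Qed.

(** Logarithms l_i of c_i are only defined up to integers; surjectivity of
    m |-> m A allows them to be chosen so that they vanish on the lambda_j. *)
Lemma torus_point_of_monomials (c : 'I_n -> R[i]) :
  (forall i, c i != 0) ->
  (forall j, \prod_i c i ^ alpha_lam iota omega i (lambda j) = 1) ->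
  exists w : torus prj omega, forall i, e_ (beta prj omega i) w = c i.
Proof.
move=> c_neq0 c_mon.
have /choice[l lE] : forall i, exists w, c i = cexp ((pi *+ 2)%:C * 'i%C * w).
  by move=> i; apply: cexp_2pii_surj.
have /choice[N NE] : forall j, exists N : int,
    \sum_i l i *~ alpha_lam iota omega i (lambda j) = (N%:~R)%:C.
  move=> j; have : cexp ((pi *+ 2)%:C * 'i%C *
      \sum_i l i *~ alpha_lam iota omega i (lambda j)) = 1.
    by rewrite -prod_cexp; under eq_bigr do rewrite -lE.
  case: (\sum_i _) => s s' /cexp_eq1_int[/intrP[N ->] ->].
  by exists N.
have [m mN] := alpha_unimodular N.
pose l' i := l i - ((m i)%:~R)%:C.
have l'E i : cexp ((pi *+ 2)%:C * 'i%C * l' i) = c i.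
  rewrite lE -[l i in RHS](subrK ((m i)%:~R)%:C).
  by rewrite [in RHS]mulrDr cexpD cexp_int mulr1.
have l'A j : \sum_i l' i *~ alpha_lam iota omega i (lambda j) = 0.
  transitivity (\sum_i l i *~ alpha_lam iota omega i (lambda j) -
     ((\sum_i m i * alpha_lam iota omega i (lambda j))%:~R)%:C).
    rewrite !rmorph_sum -sumrB; apply: eq_bigr => i _ /=.
    by rewrite mulrzBl !rmorphM /= !rmorph_int mulrzr.
  by rewrite mN NE subrr.
have [j|f1 f1E] := functional_on_t (c := fun i => complex.Re (l' i)).
  transitivity (complex.Re (\sum_i l' i *~ alpha_lam iota omega i (lambda j))).
    by rewrite (raddf_sum (@complex.Re R)); apply: eq_bigr => i _; rewrite raddfMz.
  by rewrite l'A.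
have [j|f2 f2E] := functional_on_t (c := fun i => complex.Im (l' i)).
  transitivity (complex.Im (\sum_i l' i *~ alpha_lam iota omega i (lambda j))).
    by rewrite (raddf_sum (@complex.Im R)); apply: eq_bigr => i _; rewrite raddfMz.
  by rewrite l'A.
exists (\pi_(torus prj omega) ((f1, f2) : cplx 'Hom(t, R^o)))%qT => i.
rewrite e_pi -?l'E; last by exists omega`_i => //; exact: (Zspan_mem _ i).
congr (cexp (_ * _)); rewrite /dual_evC f1E f2E.
by apply/eqP; rewrite eq_complex !eqxx.
Qed.

(** Membership in a_C makes sum_i alpha_i(u) beta_i vanish, so that it is
    killed by every form on t, in particular by the h_k. *)
Lemma alphaC_critical (f : 'Hom(t, R^o)) (u : cplx a) :
  \sum_i (f (beta prj omega i))%:C * evC (alpha iota omega i) u = 0.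
Proof.
have fab x : \sum_i f (beta prj omega i) * alpha iota omega i x = 0.
  transitivity (f (\sum_i alpha iota omega i x *: beta prj omega i)).
    by rewrite linear_sum; apply: eq_bigr => i _; rewrite linearZ [RHS]mulrC.
  by rewrite sum_alpha_beta linear0.
apply/eqP; rewrite eq_complex; apply/andP; split; apply/eqP.
  rewrite (raddf_sum (@complex.Re R)) /= -[RHS](fab u.1).
  by apply: eq_bigr => i _; rewrite /= mul0r subr0.
rewrite (raddf_sum (@complex.Im R)) /= -[RHS](fab u.2).
by apply: eq_bigr => i _; rewrite /= mul0r addr0.
Qed.

End Lattice.

Theorem lemma4p3 (R : realType) (r n d : nat) (a g t : vectType R)
  (iota : 'Hom(a, g)) (prj : 'Hom(g, t)) (omega : n.-tuple g)
  (dim_a : \dim {:a} = r) (dim_t : \dim {:t} = d)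
  (exact_seq : short_exact iota prj)
  (omega_basis : basis_of {:g} omega)
  (Gamma_a_full : full_rank (Gamma_a iota omega))
  (A_projective : projective iota omega)
  (A_spanning : spanning iota omega)
  (lambda : 'I_r -> a) (lambda_basis : Zbasis (Gamma_a iota omega) lambda)
  (h : 'I_d -> 'Hom(t, R^o))
  (h_basis : Zbasis (dual_lattice (Gamma_t prj omega)) h)
  (z : 'rV[R[i]]_n) (z_neq0 : forall i, z 0 i != 0) :
  torus_emb (prj := prj) (omega := omega) z @` O_B h z =
  alphaC iota omega @`
    [set u | U_A iota omega u /\
             forall j, p_fun iota omega (lambda j) u = q_val iota omega (lambda j) z].
Proof.
have [ker0 im_ker onto] := exact_seq.
apply/seteqP; split => [_ [w wO <-]|_ [u [uU pq] <-]].
  pose y i := z 0 i * e_ (beta prj omega i) w.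
  have [|u uy] := alphaC_image ker0 omega_basis lambda_basis (y := y).
    apply: (critical_relations im_ker onto omega_basis Gamma_a_full
              lambda_basis h_basis) => k.
    by rewrite -[RHS](wO k); apply: eq_bigr => i _; rewrite mulrAC.
  exists u; last by apply/rowP => i; rewrite !mxE uy.
  split=> [i|j]; first by rewrite uy mulf_neq0 ?cexp_neq0.
  rewrite /p_fun /q_val; under eq_bigr do rewrite uy expfzMl.
  by rewrite big_split /= (torus_monomials im_ker omega_basis lambda_basis) mulr1.
have [i|j|w wE] := torus_point_of_monomials ker0 im_ker onto omega_basis
    Gamma_a_full lambda_basis (c := fun i => evC (alpha iota omega i) u / z 0 i).
- by rewrite mulf_neq0 ?invr_neq0 //; exact: uU.
- under eq_bigr do rewrite expfzMl.
  rewrite big_split /= [X in X * _](pq j) /q_val -big_split /=.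
  by rewrite big1 // => i _; rewrite -expfzMl divff // exp1rz.
have zwE i : z 0 i * e_ (beta prj omega i) w = evC (alpha iota omega i) u.
  by rewrite wE mulrC divfK.
exists w; last by apply/rowP => i; rewrite !mxE zwE.
move=> k; rewrite -[RHS](alphaC_critical im_ker omega_basis (h k) u).
by apply: eq_bigr => i _; rewrite mulrAC zwE mulrC.
Qed.
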